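(* There is an arithmetic term $Q(a,n)$ such that for every odd $a\in\mathbb{N}$ and every $n\in\mathbb{N}$, $$a(n)=\left\lfloor\frac{Q(a,n)}{\left(2^{n+1}a\right)^n}\right\rfloor,$$ where $(a(n))$ is the odd Collatz sequence with $a(0)=a$ and $$a(n+1)=\frac{3a(n)+1}{2^{\nu_2(3a(n)+1)}}.$$
   Context: $\mathbb{N}=\{0,1,2,\dots\}$; $\nu_2(m)$ denotes the $2$-adic valuation of $m\ge1$, i.e. the largest $e$ with $2^e\mid m$. An arithmetic term is a finite expression built from variables ranging over $\mathbb{N}$ and natural-number constants by composing addition $x+y$, truncated subtraction $x \dot{-} y=\max(x-y,0)$, multiplication, $\lfloor x/y\rfloor$, $x \bmod y$, and exponentiation $x^y$ (conventions: $x \bmod 0 = x$; for definiteness $\lfloor x/0\rfloor=0$, $0^0=1$). *)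

(* Defs.v *)
From mathcomp Require Import all_boot.
Set Implicit Arguments.
Unset Strict Implicit.
Unset Printing Implicit Defensive.

(* Arithmetic terms in the variables x_0, ..., x_(k-1). *)
Inductive arith_term (k : nat) : Type :=
| AVar of 'I_k
| AConst of nat
| AAdd of arith_term k & arith_term k
| ASub of arith_term k & arith_term k
| AMul of arith_term k & arith_term k
| ADiv of arith_term k & arith_term k
| AMod of arith_term k & arith_term k
| AExp of arith_term k & arith_term k.

(* ssrnat's [-] is truncated, and the library functions satisfy
   x %/ 0 = 0, x %% 0 = x and 0 ^ 0 = 1. *)
Fixpoint arith_eval (k : nat) (v : k.-tuple nat) (t : arith_term k) : nat :=
  match t with
  | AVar i => tnth v i
  | AConst c => c
  | AAdd s t => arith_eval v s + arith_eval v t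
  | ASub s t => arith_eval v s - arith_eval v t
  | AMul s t => arith_eval v s * arith_eval v t
  | ADiv s t => arith_eval v s %/ arith_eval v t
  | AMod s t => arith_eval v s %% arith_eval v t
  | AExp s t => arith_eval v s ^ arith_eval v t
  end.

(* [logn 2 m] is the 2-adic valuation of m for m >= 1, so the division below
   is exact. *)
Fixpoint odd_collatz (a n : nat) : nat :=
  match n with
  | 0 => a
  | n'.+1 => let m := 3 * odd_collatz a n' + 1 in m %/ 2 ^ logn 2 m
  end.

(* Main.v *)
Require Import Defs.
From mathcomp Require Import all_boot all_solvable.
From mathcomp Require Import zify ring.

(* Put b_0 = a and b_(i+1) = 3 b_i + low b_i, where low b is the largest power
   of 2 dividing b; then a(n) = b_n / low b_n, and no division is needed to
   iterate. In a large base M = 2^w, the numbers y = sum_(i <= n) b_i M^i and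
   l = sum_(i <= n) (low b_i - 1) M^i form the only pair below E = M^(n+1) such
   that u(l) is a submask of v(y, l), for certain linear forms u and v.
   By Legendre's formula 'C(v, u) is odd when u is a submask of v; otherwise,
   multiplying u and v by a repunit that repeats their binary expansions H
   times makes the binomial coefficient divisible by 2^H. With z = y + E l
   ranging over all pairs, the sum c(t) of t^z 'C(v, u) is thus t^z* d modulo
   2^H = E^4, with d odd and z* the solution. Being a coefficient of a product
   of geometric series, c(t) is an arithmetic term, and
   c(1 + E^2) c(1)^(E^4 - 1) = (1 + E^2)^z* = 1 + z* E^2 modulo E^4. *)

Set Implicit Arguments.
Unset Strict Implicit.
Unset Printing Implicit Defensive.

(** * Binary masks and parity of binomial coefficients *)

(* Says that every binary digit 1 of [u] is also a digit 1 of [v]. *)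
Definition submask (u v : nat) : Prop := forall k, u %% 2 ^ k <= v %% 2 ^ k.

Lemma modn_cat_small p k u u' : k <= p -> (u + 2 ^ p * u') %% 2 ^ k = u %% 2 ^ k.
Proof.
move=> le_kp; rewrite -(subnKC le_kp) expnD -mulnA [2 ^ k * _]mulnC addnC.
by rewrite modnMDl.
Qed.

Lemma modn_cat p r u u' :
  u < 2 ^ p -> (u + 2 ^ p * u') %% 2 ^ (p + r) = u + 2 ^ p * (u' %% 2 ^ r).
Proof.
move=> ltu; have r_gt0 : 0 < 2 ^ r by rewrite expn_gt0.
have ltm := ltn_pmod u' r_gt0.
rewrite {1}(divn_eq u' (2 ^ r)) expnD.
rewrite (_ : u + _ = u' %/ 2 ^ r * (2 ^ p * 2 ^ r) + (u + 2 ^ p * (u' %% 2 ^ r)));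
  last by ring.
by rewrite modnMDl modn_small //; nia.
Qed.

Lemma submask_leq u v : submask u v -> u <= v.
Proof.
move=> /(_ (u + v)); rewrite !modn_small //.
  by apply: leq_ltn_trans (ltn_expl _ _) => //; apply: leq_addl.
by apply: leq_ltn_trans (ltn_expl _ _) => //; apply: leq_addr.
Qed.

(** Low blocks below [2 ^ p] cannot affect the comparison of distinct high blocks, so residues
    modulo [2 ^ (p + k)] compare blockwise. *)
Lemma submask_cat p u v u' v' : u < 2 ^ p -> v < 2 ^ p ->
  submask (u + 2 ^ p * u') (v + 2 ^ p * v') <-> submask u v /\ submask u' v'.
Proof.
move=> ltu ltv; split=> [d|[d d'] k].
  split=> k; have [le_kp|lt_pk] := leqP k p.
  - by have := d k; rewrite !modn_cat_small.
  - have lt2 : 2 ^ p < 2 ^ k by rewrite ltn_exp2l.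
    have := d p; rewrite !modn_cat_small // !modn_small //; lia.
  - have := d (p + k); rewrite !modn_cat //.
    have := ltn_pmod u' (expn_gt0 2 k); have := ltn_pmod v' (expn_gt0 2 k); nia.
  have := d (p + k); rewrite !modn_cat //.
  have := ltn_pmod u' (expn_gt0 2 k); have := ltn_pmod v' (expn_gt0 2 k); nia.
have [le_kp|/ltnW le_pk] := leqP k p; first by rewrite !modn_cat_small.
rewrite -(subnKC le_pk) !modn_cat // leq_add ?leq_mul //.
by have := submask_leq d.
Qed.

(** Kummer's theorem at 2, from Legendre's formula: the summand at [k] is the carry out of the
    lowest [k] digits when [m] and [j] are added. It vanishes once [2 ^ k > m + j], so any large [B]
    will do. *)
Lemma logn2_bin m j B : m + j < B ->
  logn 2 'C(m + j, m) = \sum_(1 <= k < B) ((m + j) %% 2 ^ k < m %% 2 ^ k).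
Proof.
move=> ltB.
have factE i : i < B -> logn 2 i`! = \sum_(1 <= k < B) i %/ 2 ^ k.
  move=> lt_iB; rewrite logn_fact // (@big_cat_nat _ _ _ i.+1 1 B) //=.
  rewrite [X in _ = _ + X]big_nat_cond [X in _ = _ + X]big1 ?addn0 // => k.
  rewrite andbT => /andP[lt_ik _]; apply: divn_small.
  by apply: ltn_trans lt_ik (ltn_expl _ _).
have := bin_fact (leq_addr j m); rewrite addKn => /(congr1 (logn 2)).
rewrite !lognM ?muln_gt0 ?fact_gt0 ?bin_gt0 ?leq_addr // !factE; try lia.
rewrite -big_split /= => eqs.
apply: (@addIn (\sum_(1 <= k < B) (m %/ 2 ^ k + j %/ 2 ^ k))).
rewrite eqs -big_split /=; apply: eq_bigr => k _.
have k_gt0 : 0 < 2 ^ k by rewrite expn_gt0.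
rewrite divnD // modnD // addnC; congr (_ + _).
have := ltn_pmod m k_gt0; have := ltn_pmod j k_gt0.
by case: leqP; lia.
Qed.

Lemma odd_bin_submask m n : submask m n -> odd 'C(n, m).
Proof.
move=> d; have le_mn := submask_leq d; have := d; rewrite -(subnKC le_mn) => {}d.
have : 0 < 'C(m + (n - m), m) by rewrite bin_gt0 leq_addr.
have : logn 2 'C(m + (n - m), m) = 0.
  rewrite (logn2_bin (ltnSn _)) big1 // => k _.
  by rewrite ltnNge d.
move: 'C(_, _) => c logc c_gt0; have := pfactor_dvdn 1 (isT : prime 2) c_gt0.
by rewrite logc expn1 dvdn2 => /negbFE.
Qed.

(** * Repeating a binary expansion by means of repunits *)

Definition repunit (D H : nat) : nat := \sum_(i < H) D ^ i.

Lemma repunitE D H : 1 < D -> repunit D H = (D ^ H - 1) %/ (D - 1).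
Proof.
move=> D_gt1; rewrite !subn1 predn_exp mulKn //; lia.
Qed.

Lemma repunitS D H : repunit D H.+1 = 1 + D * repunit D H.
Proof.
rewrite /repunit big_ord_recl big_distrr /=; congr (_ + _).
by apply: eq_bigr => i _; rewrite -expnS.
Qed.

Lemma repunitD D H H' :
  repunit D (H + H') = repunit D H + D ^ H * repunit D H'.
Proof.
elim: H => [|H IH]; first by rewrite /repunit !big_ord0 add0n mul1n.
by rewrite addSn !repunitS IH expnS; ring.
Qed.

Lemma ltn_repunit D H u : u < D -> u * repunit D H < D ^ H.
Proof.
move=> ltu; elim: H => [|H IH]; first by rewrite /repunit big_ord0 muln0.
by rewrite repunitS expnS; nia.
Qed.

Section Replication.
Variables (q : nat).
Local Notation rho := (repunit (2 ^ q)).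

Lemma submask_rep H u v : u < 2 ^ q -> v < 2 ^ q -> submask u v ->
  submask (u * rho H) (v * rho H).
Proof.
move=> ltu ltv d; elim: H => [|H IH].
  by rewrite /repunit big_ord0 !muln0 => k.
rewrite !repunitS !mulnDr !muln1 !(mulnCA _ (2 ^ q)).
exact/submask_cat.
Qed.

(** The cut falls inside copy [j]: below it lie [j] whole copies and the first [r] digits of one
    more. *)
Lemma modn_rep H j r u : j < H -> r <= q -> u < 2 ^ q ->
  (u * rho H) %% 2 ^ (q * j + r) = u * rho j + 2 ^ (q * j) * (u %% 2 ^ r).
Proof.
move=> lt_jH le_rq ltu.
have -> : H = j + (H - j).-1.+1 by lia.
have ltj : u * rho j < 2 ^ (q * j) by rewrite expnM ltn_repunit.
rewrite repunitD -expnM mulnDr mulnCA modn_cat //; congr (_ + _ * _).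
by rewrite repunitS mulnDr muln1 mulnCA modn_cat_small.
Qed.

Lemma leq_sum_blocks (f : nat -> bool) H :
  (forall j, j < H -> exists2 r, 0 < r <= q & f (q * j + r)) ->
  H <= \sum_(1 <= k < (q * H).+1) f k.
Proof.
elim: H => // H IH fH; rewrite (@big_cat_nat _ _ _ (q * H).+1) //=; last by rewrite mulnS; lia.
have [r /andP[r_gt0 le_rq] fr] := fH H (ltnSn H).
rewrite -addn1 leq_add ?IH // => [j ltj|]; first by apply: fH; apply: ltnW.
rewrite (@big_cat_nat _ _ _ (q * H + r)) //=; try by rewrite ?mulnS; lia.
by rewrite [X in _ + X]big_ltn ?fr ?mulnS; lia.
Qed.

(** A comparison of residues that fails at [r] fails again at [q * j + r] in each of the [H] copies,
    because [j] copies of [v] stay below [2 ^ (q * j)]. These are [H] carries. *)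
Lemma dvdn_bin_rep H u v : u < 2 ^ q -> v < 2 ^ q -> ~ submask u v ->
  2 ^ H %| 'C(v * rho H, u * rho H).
Proof.
move=> ltu ltv nd.
have [lt_vu|le_uv] := ltnP (v * rho H) (u * rho H); first by rewrite bin_small.
(* Residues modulo [2 ^ 0] agree, and beyond [q] they are [u] and [v] themselves, as at [q]; so some
   failure lies within one block. *)
have [r /andP[r_gt0 le_rq] lt_r] : exists2 r, 0 < r <= q & v %% 2 ^ r < u %% 2 ^ r.
  have [/existsP[r lt_r]|no] := boolP [exists r : 'I_q.+1, v %% 2 ^ r < u %% 2 ^ r].
    exists (val r) => //; rewrite -[_ <= q]ltnS ltn_ord andbT lt0n.
    by apply: contraTneq lt_r => ->; rewrite !modn1.
  case: nd => k; have [le_kq|lt_qk] := leqP k q.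
    rewrite leqNgt; apply: contra no => lt_k.
    by apply/existsP; exists (Ordinal (le_kq : k < q.+1)).
  have lt2 : 2 ^ q < 2 ^ k by rewrite ltn_exp2l.
  rewrite !modn_small; try lia.
  rewrite leqNgt; apply: contra no => lt_vu.
  by apply/existsP; exists ord_max; rewrite /= !modn_small.
rewrite pfactor_dvdn ?bin_gt0 //.
(* This bound meets the hypothesis of [logn2_bin] and keeps every position up to [q * H] in the
   sum. *)
have : v * rho H < v * rho H + (q * H).+1 by lia.
rewrite -{1 3}(subnKC le_uv) => /logn2_bin->; rewrite subnKC //.
rewrite (@big_cat_nat _ _ _ (q * H).+1) //=; last by lia.
apply: leq_trans (leq_addr _ _).
apply: (@leq_sum_blocks (fun k => _ %% 2 ^ k < _ %% 2 ^ k)) => j lt_jH.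
exists r; first by rewrite r_gt0.
rewrite !modn_rep //.
have e_gt0 : 0 < 2 ^ (q * j) by rewrite expn_gt0.
have ltj := ltn_repunit j ltv; rewrite -expnM in ltj.
have := leq0n (u * rho j).
nia.
Qed.

End Replication.

(** * Sums of binomial coefficients as digits of a product of geometric series *)

(** Grouped by exponent, the terms form a base [X] expansion without carries, since even the total
    of all [m j] is below [X]. *)
Lemma digit_sum (J : finType) (m k : J -> nat) X T : \sum_j m j < X ->
  ((\sum_j m j * X ^ k j) %/ X ^ T) %% X = \sum_(j | k j == T) m j.
Proof.
move=> ltX; have X_gt0 : 0 < X by apply: leq_ltn_trans ltX.
rewrite (bigID (fun j => k j < T)) /= [X in _ + X](bigID (fun j => k j == T)) /=.
have sum_le (P : pred J) : \sum_(j | P j) m j < X.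
  by apply: leq_ltn_trans ltX; rewrite [leqRHS](bigID P) /= leq_addr.
have low : \sum_(j | k j < T) m j * X ^ k j < X ^ T.
  case: T => [|T]; first by rewrite big_pred0.
  apply: (@leq_ltn_trans (\sum_(j | k j < T.+1) m j * X ^ T)).
    by apply: leq_sum => j lt_j; rewrite leq_mul // leq_pexp2l.
  by rewrite -big_distrl /= expnS ltn_mul2r expn_gt0 X_gt0 sum_le.
have -> : \sum_(j | ~~ (k j < T) && (k j == T)) m j * X ^ k j =
    (\sum_(j | k j == T) m j) * X ^ T.
  rewrite big_distrl /=; apply: eq_big => [j|j /andP[_ /eqP->] //].
  by case: eqP => [->|]; rewrite ?ltnn ?andbF.
have -> : \sum_(j | ~~ (k j < T) && (k j != T)) m j * X ^ k j =
    (\sum_(j | ~~ (k j < T) && (k j != T)) m j * X ^ (k j - T.+1)) * X * X ^ T.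
  rewrite !big_distrl /=; apply: eq_bigr => j ltj.
  by rewrite -!mulnA -expnS -expnD; congr (_ * _ ^ _); lia.
by rewrite -mulnDl addnC divnMDl ?expn_gt0 ?X_gt0 // (divn_small low) addn0
           addnC modnMDl modn_small.
Qed.

(** The homogeneous geometric sum, as a quotient so that it is an arithmetic term in its
    arguments. *)
Definition geom (x y E : nat) : nat := (x ^ E - y ^ E) %/ (x - y).

Lemma geomE x y E : y < x -> geom x y E = \sum_(i < E) x ^ i * y ^ (E - 1 - i).
Proof.
move=> lt_yx; rewrite /geom subn_exp mulKn ?subn_gt0 // (reindex_inj rev_ord_inj) /=.
by apply: eq_bigr => i _; congr (_ ^ _ * _ ^ _); have := ltn_ord i; lia.
Qed.

Lemma sum_bin n B : n < B -> \sum_(i < B) 'C(n, i) = 2 ^ n.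
Proof.
move=> ltB; have <- : \sum_(i < n.+1) 'C(n, i) = 2 ^ n.
  rewrite -[2]/(1 + 1) expnDn; apply: eq_bigr => i _.
  by rewrite !exp1n !muln1.
rewrite [RHS](big_ord_widen _ (fun i => 'C(n, i)) ltB) [LHS](bigID (fun i : 'I_B => i < n.+1)) /=.
by rewrite [X in _ + X]big1 ?addn0 // => i; rewrite -leqNgt => /bin_small.
Qed.

Lemma exp_onep X n B : n < B -> (1 + X) ^ n = \sum_(i < B) 'C(n, i) * X ^ i.
Proof.
move=> ltB; rewrite expnDn.
rewrite [LHS](big_ord_widen _ (fun i => 'C(n, i) * (1 ^ (n - i) * X ^ i)) ltB).
rewrite [RHS](bigID (fun i : 'I_B => i < n.+1)) /= [X in _ = _ + X]big1 ?addn0.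
  by apply: eq_bigr => i _; rewrite exp1n mul1n.
by move=> i; rewrite -leqNgt => /bin_small->.
Qed.

Section BinomialSums.
Variables (E A0 A1 A2 u0 u2 th : nat).

Definition wbin_sum : nat := \sum_(p : 'I_E * 'I_E)
  th ^ (p.1 + E * p.2) * 'C(A0 + A1 * p.1 + A2 * p.2, u0 + u2 * p.2).

(** Exceeds the sum of all coefficients of the generating function: there are [E * E] pairs, each
    weight is at most [th ^ (E * E)], and each row of binomial coefficients sums to at most the
    power of 2. *)
Definition wbin_base : nat := E * E * th ^ (E * E) * 2 ^ (A0 + (A1 + A2) * E) + 1.

Definition wbin_gf : nat :=
  (1 + wbin_base) ^ A0 * geom ((1 + wbin_base) ^ A1 * th) 1 E
  * geom ((1 + wbin_base) ^ A2 * th ^ E) (wbin_base ^ u2) E.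

(* The sum is a coefficient of a product of geometric series in [X]: with
   [N = A0 + A1 y + A2 l] and [u = u0 + u2 l], it is the coefficient of
   [X ^ (u0 + u2 (E - 1))] in the sum over [y, l] of
   [th ^ (y + E l) (1 + X) ^ N X ^ (u2 (E - 1 - l))]. *)
Lemma wbin_sumE : 0 < th -> 0 < A1 -> 0 < A2 -> u2 <= A2 ->
  wbin_sum = (wbin_gf %/ wbin_base ^ (u0 + u2 * (E - 1))) %% wbin_base.
Proof.
move=> th_gt0 A1_gt0 A2_gt0 le_u2; set X := wbin_base.
case: (posnP E) => [E0|E_gt0].
  have X1 : X = 1 by rewrite /X /wbin_base E0.
  by rewrite X1 modn1 /wbin_sum E0 big1 // => [[[i]]].
have X_gt1 : 1 < X.
  by rewrite /X /wbin_base addn1 ltnS !muln_gt0 !expn_gt0 E_gt0 th_gt0.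
(* A common bound on the upper indices, so that every power of [1 + X] expands over the same
   range. *)
pose B := (A0 + (A1 + A2) * E).+1.
have ltB (p : 'I_E * 'I_E) : A0 + A1 * p.1 + A2 * p.2 < B.
  by rewrite /B; have := ltn_ord p.1; have := ltn_ord p.2; nia.
pose m (j : ('I_E * 'I_E) * 'I_B) :=
  th ^ (j.1.1 + E * j.1.2) * 'C(A0 + A1 * j.1.1 + A2 * j.1.2, j.2).
pose k (j : ('I_E * 'I_E) * 'I_B) := j.2 + u2 * (E - 1 - j.1.2).
(* [geomE] needs its first argument strictly larger; for the second series this rests on
   [u2 <= A2]. *)
have lt1 : 1 < (1 + X) ^ A1 * th.
  apply: leq_trans (leq_pmulr _ th_gt0).
  by apply: leq_trans (ltn_expl A1 (_ : 1 < 1 + X)); lia.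
have lt2 : X ^ u2 < (1 + X) ^ A2 * th ^ E.
  apply: leq_trans (leq_pmulr _ _); last by rewrite expn_gt0 th_gt0.
  apply: (@leq_ltn_trans (X ^ A2)); first by rewrite leq_pexp2l //; lia.
  by rewrite ltn_exp2r //.
have -> : wbin_gf = \sum_j m j * X ^ k j.
  rewrite /wbin_gf -/X !geomE // -mulnA big_distrlr /= pair_big /= big_distrr /=.
  rewrite -(pair_bigA _ (fun p i => m (p, i) * X ^ k (p, i))) /=.
  apply: eq_bigr => p _; rewrite /m /k /= exp1n muln1.
  rewrite (eq_bigr (fun i : 'I_B => th ^ (p.1 + E * p.2) * X ^ (u2 * (E - 1 - p.2))
      * ('C(A0 + A1 * p.1 + A2 * p.2, i) * X ^ i))); last first.
    by move=> i _; rewrite (expnD X); ring.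
  rewrite -big_distrr /= -(exp_onep _ (ltB p)) !expnMn -!expnM !expnD !expnM.
  rewrite -!expnM.
 ring.
rewrite digit_sum; last first.
  rewrite /X /wbin_base addn1 ltnS -(pair_bigA _ (fun p i => m (p, i))) /= /m /=.
  apply: (@leq_trans (\sum_(p : 'I_E * 'I_E)
      th ^ (E * E) * 2 ^ (A0 + (A1 + A2) * E))).
    apply: leq_sum => p _; rewrite -big_distrr /= (sum_bin (ltB p)).
    rewrite leq_mul // leq_pexp2l //; last exact: ltB.
    by have := ltn_ord p.1; have := ltn_ord p.2; nia.
  by rewrite sum_nat_const card_prod card_ord mulnA.
rewrite (eq_bigl (fun j : (('I_E * 'I_E) * 'I_B)%type => j.2 == u0 + u2 * j.1.2 :> nat)); last first.
  move=> [[y l] i]; rewrite /k /=; have := ltn_ord l.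
  have -> : u2 * (E - 1) = u2 * (E - 1 - l) + u2 * l.
    by rewrite -mulnDr; congr (_ * _); have := ltn_ord l; lia.
  by rewrite [u2 * (E - 1 - l) + _]addnC addnA eqn_add2r.
rewrite -(pair_big_dep xpredT
  (fun p (i : 'I_B) => i == u0 + u2 * (p : 'I_E * 'I_E).2 :> nat) (fun p i => m (p, i))) /=.
apply: eq_bigr => p _; rewrite /m /=.
(* A lower index outside ['I_B] is missing from the sum, but its binomial coefficient is 0
   anyway. *)
have [lt_uB|le_Bu] := ltnP (u0 + u2 * p.2) B; first by rewrite (big_pred1 (Ordinal lt_uB)).
rewrite bin_small ?muln0 ?big_pred0 // => [i|].
  by apply: ltn_eqF; apply: leq_trans (ltn_ord i) le_Bu.
exact: leq_trans (ltB p) le_Bu.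
Qed.

End BinomialSums.

(** * Encoding a Collatz trajectory by masks *)

Lemma submask_refl u : submask u u.
Proof. by move=> k. Qed.

Lemma submask0 v : submask 0 v.
Proof. by move=> k; rewrite mod0n. Qed.

Lemma submask1_odd c : odd c -> submask 1 c.
Proof.
move=> odd_c [|k]; first by rewrite !modn1.
apply: leq_trans (leq_mod _ _) _; rewrite lt0n; apply: contraTneq odd_c => c0.
by rewrite -dvdn2 (@dvdn_trans (2 ^ k.+1)) ?dvdn_exp // /dvdn c0.
Qed.

Lemma submask_ones p Z : submask (2 ^ p - 1) Z <-> Z %% 2 ^ p = 2 ^ p - 1.
Proof.
have p_gt0 : 0 < 2 ^ p by rewrite expn_gt0.
have ltZ := ltn_pmod Z p_gt0.
split=> [/(_ p)|Zp k]; first by rewrite [X in X <= _]modn_small; lia.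
have [le_kp|/ltnW le_pk] := leqP k p.
  by rewrite -(modn_dvdm Z (dvdn_exp2l 2 le_kp)) Zp.
apply: leq_trans (leq_mod _ _) _.
rewrite -Zp -(modn_dvdm Z (dvdn_exp2l 2 le_pk)).
exact: leq_mod.
Qed.

Definition low (b : nat) : nat := 2 ^ logn 2 b.

Lemma low_gt0 b : 0 < low b.
Proof. by rewrite expn_gt0. Qed.

Lemma low_odd_part b : 0 < b -> exists2 c, odd c & b = low b * c.
Proof.
move=> b_gt0; have [c co_c {1}->] := pfactor_coprime (isT : prime 2) b_gt0.
by exists c; rewrite 1?mulnC // -coprime2n.
Qed.

Lemma leq_low b : 0 < b -> low b <= b.
Proof. by move=> b_gt0; apply: dvdn_leq => //; apply: pfactor_dvdnn. Qed.

Lemma submask_low b : 0 < b -> submask (low b) b.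
Proof.
move=> b_gt0; have [c odd_c {2}->] := low_odd_part b_gt0.
rewrite -[X in submask X]muln1 -[_ * 1]add0n -[_ * c]add0n.
apply/submask_cat; rewrite ?low_gt0 //; split; first exact: submask0.
exact: submask1_odd.
Qed.

Lemma submask_low_pred b : 0 < b -> submask (low b - 1) (b + (low b - 1)).
Proof.
move=> b_gt0; have [c odd_c {2}->] := low_odd_part b_gt0.
have ltl : low b - 1 < low b by rewrite subn1 prednK // low_gt0.
have [_] := submask_cat 0 c ltl ltl.
rewrite muln0 addn0 addnC; apply; split; [exact: submask_refl | exact: submask0].
Qed.

Lemma modn_exp2S x r : x %% 2 ^ r.+1 = x %% 2 ^ r + 2 ^ r * odd (x %/ 2 ^ r).
Proof.
have r_gt0 : 0 < 2 ^ r by rewrite expn_gt0.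
rewrite {1}(divn_eq x (2 ^ r)) addnC mulnC -[r.+1]addn1 modn_cat ?ltn_pmod //.
by rewrite expn1 modn2.
Qed.

(* The two submask conditions say that [l] and [b] are disjoint and that
   [l + 1] is contained in [b]; hence [l + 1] is a power of two. *)
Lemma low_unique w b l : 0 < b -> b < 2 ^ w ->
  (forall r, r <= w -> (1 + l) %% 2 ^ r <= b %% 2 ^ r) ->
  (forall r, r <= w -> l %% 2 ^ r <= (b + l) %% 2 ^ r) ->
  l %% 2 ^ w = low b - 1.
Proof.
move=> b_gt0 ltb subl disj; have [c odd_c bE] := low_odd_part b_gt0.
rewrite /low in bE *; set e := logn 2 b in bE *.
have e_gt0 : 0 < 2 ^ e by rewrite expn_gt0.
have lt_ew : e < w by rewrite -(@ltn_exp2l 2) // (leq_ltn_trans _ ltb) // leq_low.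
suff loop d : e + d <= w -> l %% 2 ^ (e + d) = 2 ^ e - 1.
  by rewrite -(subnKC (ltnW lt_ew)) loop // subnKC // ltnW.
elim: d => [|d IH] le_dw; rewrite ?addn0 ?addnS in le_dw *.
  (* The lowest [e] digits of [b] are 0, so [1 + l] must vanish modulo [2 ^ e]. *)
  have := subl e le_dw; rewrite {1}bE modnMr leqn0 -modnDmr.
  have ltl := ltn_pmod l e_gt0.
  have [lt1|] := ltnP (1 + l %% 2 ^ e) (2 ^ e); first by rewrite modn_small.
  by lia.
have {}IH := IH (ltnW le_dw); set r := e + d in le_dw IH *.
have r_gt0 : 0 < 2 ^ r by rewrite expn_gt0.
have le_er : 2 ^ e <= 2 ^ r by rewrite leq_exp2l // leq_addr.
have lE := modn_exp2S l r; rewrite IH in lE.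
case: (odd (l %/ 2 ^ r)) lE => lE; rewrite ?muln0 ?muln1 ?addn0 in lE => //.
(* If [l] had digit 1 at [r], so would [b]: for [d = 0] because [c] is odd, otherwise because the
   carry in [1 + l] stops at position [e < r]. *)
have bit_b : b %% 2 ^ r.+1 = b %% 2 ^ r + 2 ^ r.
  have := modn_exp2S b r; case: (posnP d) => [d0|d_gt0].
    by rewrite /r d0 addn0 bE mulKn // odd_c muln1.
  have lt_er : 2 ^ e < 2 ^ r by rewrite ltn_exp2l // /r; lia.
  have := subl r.+1 le_dw; rewrite -modnDmr lE modn_small ?expnS; last by lia.
  by have := ltn_pmod b r_gt0; case: odd; lia.
(* The two digits 1 at [r] carry out, which leaves the residue of [b + l] below that of [l]. *)
have := disj r.+1 le_dw; rewrite lE -modnDm lE bit_b.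
have ltb2 := ltn_pmod b r_gt0.
rewrite (_ : _ + _ + _ = b %% 2 ^ r + (2 ^ e - 1) + 2 ^ r.+1); last by rewrite expnS; lia.
by rewrite modnDr modn_small ?expnS; lia.
Qed.

Definition digsum (M : nat) (f : nat -> nat) (i : nat) : nat :=
  \sum_(j < i) M ^ j * f j.

Lemma digsumS M f i : digsum M f i.+1 = digsum M f i + M ^ i * f i.
Proof. by rewrite /digsum big_ord_recr. Qed.

Lemma digsumD M f g i : digsum M f i + digsum M g i = digsum M (fun j => f j + g j) i.
Proof. by rewrite /digsum -big_split /=; apply: eq_bigr => j _; rewrite mulnDr. Qed.

Lemma ltn_digsum M f i : (forall j, j < i -> f j < M) -> digsum M f i < M ^ i.
Proof.
elim: i => [|i IH] ltf; first by rewrite /digsum big_ord0.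
have lt_fi := ltf i (ltnSn i); have {}IH := IH (fun j ltj => ltf j (ltnW ltj)).
by rewrite digsumS expnS; nia.
Qed.

Lemma repunit_digsum M i : repunit M i = digsum M (fun=> 1) i.
Proof. by apply: eq_bigr => j _; rewrite muln1. Qed.

Lemma submask_digsum w f g i :
  (forall j, j < i -> [/\ f j < 2 ^ w, g j < 2 ^ w & submask (f j) (g j)]) ->
  submask (digsum (2 ^ w) f i) (digsum (2 ^ w) g i).
Proof.
elim: i => [|i IH] sub; first by rewrite /digsum !big_ord0; apply: submask_refl.
have [_ _ sub_i] := sub i (ltnSn i); rewrite !digsumS -expnM.
apply/submask_cat; last by split=> //; apply: IH => j ltj; apply: sub; apply: ltnW.
  by rewrite expnM ltn_digsum // => j ltj; have [] := sub j (ltnW ltj).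
by rewrite expnM ltn_digsum // => j ltj; have [] := sub j (ltnW ltj).
Qed.

Fixpoint collatz_num (a i : nat) : nat :=
  if i is i'.+1 then 3 * collatz_num a i' + low (collatz_num a i') else a.

Lemma collatz_num_gt0 a i : 0 < a -> 0 < collatz_num a i.
Proof. by move=> a_gt0; case: i => //= i; rewrite addn_gt0 low_gt0 orbT. Qed.

Lemma collatz_num_leq a i : 0 < a -> collatz_num a i <= 4 ^ i * a.
Proof.
move=> a_gt0; elim: i => [|i IH] /=; first by rewrite mul1n.
by have := leq_low (collatz_num_gt0 i a_gt0); rewrite expnS; lia.
Qed.

(** Taking [low b_i] out of [3 b_i + low b_i] leaves [3 a(i) + 1], whose odd part is [a(i+1)]. *)
Lemma collatz_num_odd_collatz a i : odd a ->
  odd (odd_collatz a i) /\ collatz_num a i = low (collatz_num a i) * odd_collatz a i.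
Proof.
move=> odd_a; have a_gt0 := odd_gt0 odd_a.
elim: i => [|i [odd_i IH]].
  by rewrite /= /low logn_coprime ?mul1n // coprime2n.
set m := 3 * odd_collatz a i + 1.
have m_gt0 : 0 < m by rewrite /m addn1.
have [c odd_c mE] := low_odd_part m_gt0.
have oS : odd_collatz a i.+1 = c.
  by rewrite /= -/m {1}mE -/(low m) mulKn ?low_gt0.
have bS : collatz_num a i.+1 = low (collatz_num a i) * m.
  by rewrite /= {1}IH /m; ring.
rewrite oS; split=> //.
have -> : low (collatz_num a i.+1) = low (collatz_num a i) * low m.
  by rewrite bS {1}/low lognM ?low_gt0 // expnD /low pfactorK.
by rewrite bS {1}mE mulnA.
Qed.

(** Since [b_i <= 4 ^ n * a <= 2 ^ (2 * n + a)] for [i <= n], one further bit leaves room for the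
    digit [b_i + (low b_i - 1)]. *)
Definition width (a n : nat) : nat := 2 * n + a + 1.
Definition dbase (a n : nat) : nat := 2 ^ width a n.
Definition box (a n : nat) : nat := dbase a n ^ (n + 1).
Definition dunit (a n : nat) : nat := (box a n - 1) %/ (dbase a n - 1).

(* A pair [(y, l)] below [box] encodes the first [n + 1] terms of the Collatz
   numerators and of their low bits minus 1, as base [dbase] digits, when the
   mask of [l] below is contained in that of [(y, l)]: the three blocks, in
   base [2 * box], read
   [dunit + l] in [y], [l] in [y + l], and
   [box - 1] in [a + dbase * (3 y + dunit + l) + (box - 1 - y)]. *)
Definition mu0 (a n : nat) : nat :=
  dunit a n + 2 * box a n * (2 * box a n * (box a n - 1)).
Definition mu2 (a n : nat) : nat := 1 + 2 * box a n.
Definition mv0 (a n : nat) : nat :=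
  2 * box a n * (2 * box a n * (dbase a n * dunit a n + a + box a n - 1)).
Definition mv1 (a n : nat) : nat :=
  1 + 2 * box a n * (1 + 2 * box a n * (3 * dbase a n - 1)).
Definition mv2 (a n : nat) : nat :=
  2 * box a n * (1 + 2 * box a n * dbase a n).

Section Encoding.
Variables (a n : nat).
Hypothesis odd_a : odd a.
Let a_gt0 : 0 < a := odd_gt0 odd_a.
Local Notation w := (width a n).
Local Notation M := (dbase a n).
Local Notation E := (box a n).
Local Notation R := (dunit a n).
Local Notation b := (collatz_num a).
Let lpred i := low (b i) - 1.

Definition ynum : nat := digsum M b (n + 1).
Definition lnum : nat := digsum M (fun i => low (collatz_num a i) - 1) (n + 1).

Lemma dbase_gt1 : 1 < M.
Proof. by rewrite -[1]/(2 ^ 0) ltn_exp2l // /width addn1. Qed.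

Lemma box_gt1 : 1 < E.
Proof. by rewrite /box -[1]/(M ^ 0) ltn_exp2l ?dbase_gt1 // addn1. Qed.

Lemma boxE : E = 2 ^ (w * (n + 1)).
Proof. by rewrite expnM. Qed.

Lemma dunitE : R = digsum M (fun=> 1) (n + 1).
Proof. by rewrite -repunit_digsum repunitE ?dbase_gt1. Qed.

Lemma dunit_lt : R < E.
Proof. by rewrite dunitE ltn_digsum // => j _; apply: dbase_gt1. Qed.

Lemma collatz_num_small i : i < n + 1 -> 2 * b i <= M.
Proof.
move=> lt_i; rewrite /dbase /width addn1 expnS leq_mul2l /=.
apply: leq_trans (collatz_num_leq i a_gt0) _.
rewrite expnD leq_mul //; last by apply: ltnW; apply: ltn_expl.
by rewrite -[4]/(2 ^ 2) -expnM leq_exp2l //; lia.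
Qed.

Lemma digits_small i : i < n + 1 ->
  [/\ b i < M, low (b i) < M, low (b i) - 1 < M & b i + (low (b i) - 1) < M].
Proof.
move=> lt_i; have := collatz_num_small lt_i.
have b_gt0 := collatz_num_gt0 i a_gt0; have := leq_low b_gt0; have := low_gt0 (b i).
by split; lia.
Qed.

Lemma digsum_low i :
  digsum M (fun=> 1) i + digsum M lpred i = digsum M (fun j => low (b j)) i.
Proof.
rewrite digsumD; apply: eq_bigr => j _.
by rewrite /lpred subnKC ?low_gt0.
Qed.

(** The recurrence packed into one linear equation: the factor [M] shifts every digit up by one
    place, and [a] fills place 0. *)
Lemma digsum_step i :
  a + M * (3 * digsum M b i + digsum M (fun j => low (b j)) i) = digsum M b i.+1.
Proof.
elim: i => [|i IH]; first by rewrite digsumS /digsum !big_ord0 expn0 /=; ring.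
rewrite [RHS]digsumS [digsum M b i.+1 in LHS]digsumS -{}IH [digsum M _ i.+1]digsumS expnS /=.
ring.
Qed.

Lemma ynum_lt : ynum < E.
Proof. by apply: ltn_digsum => j /digits_small[]. Qed.

Lemma lnum_lt : lnum < E.
Proof. by apply: ltn_digsum => j /digits_small[]. Qed.

(** Base [2 * E] keeps the blocks apart, as [R + l] and [y + l] are below it; the top block needs no
    bound. *)
Lemma mask_blocks y l : y < E -> l < E ->
  submask (mu0 a n + mu2 a n * l) (mv0 a n + mv1 a n * y + mv2 a n * l) <->
  [/\ submask (R + l) y, submask l (y + l) &
      submask (E - 1) (a + M * (3 * y + (R + l)) + (E - 1 - y))].
Proof.
move=> lty ltl; set Z := a + _ + _.
have PE : 2 * E = 2 ^ (w * (n + 1)).+1 by rewrite expnS -boxE.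
have E_gt1 := box_gt1; have M_gt1 := dbase_gt1; have ltR := dunit_lt.
have -> : mu0 a n + mu2 a n * l = (R + l) + 2 * E * (l + 2 * E * (E - 1)).
  by rewrite /mu0 /mu2; ring.
have -> : mv0 a n + mv1 a n * y + mv2 a n * l = y + 2 * E * ((y + l) + 2 * E * Z).
  have -> : Z = (M * R + a + E - 1) + (3 * M - 1) * y + M * l.
    have : y <= 3 * M * y by nia.
    by rewrite /Z mulnBl; lia.
  by rewrite /mv0 /mv1 /mv2; ring.
rewrite PE; split=> [|[s1 s2 s3]].
  move/submask_cat; rewrite -PE; case; try lia; rewrite PE => s1.
  by move/submask_cat; rewrite -PE; case; try lia; split.
apply/submask_cat; rewrite -?PE; try lia; split=> //; rewrite PE.
by apply/submask_cat; rewrite -?PE; try lia.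
Qed.

Lemma mask_ynum_lnum :
  submask (mu0 a n + mu2 a n * lnum) (mv0 a n + mv1 a n * ynum + mv2 a n * lnum).
Proof.
apply/mask_blocks; rewrite ?ynum_lt ?lnum_lt //.
rewrite dunitE digsum_low digsumD; split.
- apply: submask_digsum => j ltj; have [? ? _ _] := digits_small ltj; split=> //.
  by apply: submask_low; apply: collatz_num_gt0.
- apply: submask_digsum => j ltj; have [? ? ? ?] := digits_small ltj; split=> //.
  by apply: submask_low_pred; apply: collatz_num_gt0.
(* The shifted number is [ynum] with the extra digit [b (n + 1)] at weight [E]; adding
   [E - 1 - ynum] leaves [E - 1] modulo [E]. *)
rewrite digsum_step digsumS -/ynum -/(box a n).
rewrite boxE; apply/submask_ones; rewrite -boxE.
have := ynum_lt; have := box_gt1 => E_gt1 lty.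
rewrite (_ : _ + _ = b (n + 1) * E + (E - 1)); first by rewrite modnMDl modn_small; lia.
by rewrite mulnC; lia.
Qed.

(** Digits are forced from the bottom up: by the third block, the first [i] digits of [y] and [l]
    determine digit [i] of [y], and [low_unique] applied to the first two blocks then yields digit
    [i] of [l]. *)
Lemma mask_prefix y l i : y < E -> l < E ->
  submask (mu0 a n + mu2 a n * l) (mv0 a n + mv1 a n * y + mv2 a n * l) ->
  i <= n + 1 -> y %% M ^ i = digsum M b i /\ l %% M ^ i = digsum M lpred i.
Proof.
move=> lty ltl /(mask_blocks lty ltl)[s1 s2 s3].
have E_gt1 := box_gt1; have M_gt1 := dbase_gt1.
have yE : a + M * (3 * y + (R + l)) = y %[mod E].
  move: s3; rewrite boxE => /submask_ones; rewrite -boxE => modE.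
  set X := a + _ in modE *; have XE : X + (E - 1 - y) = (E - 1) %[mod E].
    by rewrite modE modn_small //; lia.
  apply/eqP; rewrite -(eqn_modDr (E - 1 - y)); apply/eqP; rewrite XE.
  by congr (_ %% _); lia.
elim: i => [|i IH] le_i; first by rewrite /digsum !big_ord0 !modn1.
have [yi li] := IH (ltnW le_i).
have ltdig f : (forall j, j < n + 1 -> f j < M) -> digsum M f i < M ^ i.
  by move=> ltf; apply: ltn_digsum => j ltj; apply: ltf; apply: ltn_trans ltj le_i.
have RE : R = digsum M (fun=> 1) i + M ^ i * repunit M (n + 1 - i).
  by rewrite dunitE -!repunit_digsum -repunitD subnKC // ltnW.
have yS : y %% M ^ i.+1 = digsum M b i.+1.
  have dvd : M ^ i.+1 %| E by apply: dvdn_exp2l.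
  rewrite -(modn_dvdm y dvd) -yE (modn_dvdm _ dvd) -digsum_step -digsum_low.
  rewrite -yi -li -[RHS](@modn_small _ (M ^ i.+1)); last first.
    rewrite yi li digsum_low digsum_step ltn_digsum // => j ltj.
    by have [] := digits_small (leq_trans ltj le_i).
  apply/eqP; rewrite eqn_modDl expnS -!muln_modr; apply/eqP; congr (_ * _).
  have -> : 3 * y + (R + l) =
      (3 * (y %/ M ^ i) + repunit M (n + 1 - i) + l %/ M ^ i) * M ^ i
      + (3 * (y %% M ^ i) + (digsum M (fun=> 1) i + l %% M ^ i)).
    by rewrite {1}(divn_eq y (M ^ i)) {1}(divn_eq l (M ^ i)) RE; ring.
  by rewrite modnMDl addnA.
split=> //; rewrite digsumS.
set l' := l %/ M ^ i; set y' := y %/ M ^ i.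
have lE : l = digsum M lpred i + M ^ i * l' by rewrite -li addnC mulnC -divn_eq.
have yE' : y = digsum M b i + M ^ i * y' by rewrite -yi addnC mulnC -divn_eq.
have Mi : M ^ i = 2 ^ (w * i) by rewrite expnM.
have MS : M ^ i.+1 = 2 ^ (w * i + w) by rewrite mulnC -mulSnr mulnC expnM.
have y'E : y' %% 2 ^ w = b i.
  move: yS; rewrite {1}yE' digsumS MS Mi modn_cat; last first.
    by rewrite -Mi ltdig // => j /digits_small[].
  by move/addnI/eqP; rewrite eqn_pmul2l ?expn_gt0 // => /eqP.
rewrite {1}lE MS Mi modn_cat; last by rewrite -Mi ltdig // => j /digits_small[].
congr (_ + _ * _); apply: low_unique.
- exact: collatz_num_gt0.
- by have [] := digits_small le_i.
- move=> r le_rw; move: s1; rewrite RE {1}lE yE'.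
  rewrite (_ : _ + _ + _ = digsum M (fun j => low (b j)) i
      + M ^ i * (repunit M (n + 1 - i) + l')); last by rewrite -digsum_low; ring.
  rewrite Mi => /submask_cat; rewrite -Mi; case; try by apply: ltdig => j /digits_small[].
  move=> _ /(_ r); rewrite -y'E.
  rewrite (modn_dvdm _ (dvdn_exp2l 2 le_rw)).
  have -> : n + 1 - i = (n - i).+1 by move: le_i; rewrite addn1 => /subSn.
  have ME : M = 2 ^ (w - r) * 2 ^ r by rewrite -expnD (subnK le_rw).
  (* Of the remaining digits of [R], only the lowest survives modulo [2 ^ r], as [2 ^ r] divides
     [M]. *)
  rewrite repunitS (_ : _ + _ + _ =
    2 ^ (w - r) * repunit M (n - i) * 2 ^ r + (1 + l %/ M ^ i)); last first.
    by rewrite {1}ME; ring.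
  by rewrite modnMDl.
move=> r le_rw; move: s2; rewrite {1 2}lE yE'.
rewrite (_ : digsum M b i + _ + _ = digsum M (fun j => b j + lpred j) i
    + M ^ i * (y' + l')); last by rewrite -digsumD; ring.
rewrite Mi => /submask_cat; rewrite -Mi; case; try by apply: ltdig => j /digits_small[].
move=> _ /(_ r); rewrite -y'E -modnDml -[X in _ -> _ <= X]modnDml.
by rewrite (modn_dvdm _ (dvdn_exp2l 2 le_rw)).
Qed.

Lemma mask_unique y l : y < E -> l < E ->
  submask (mu0 a n + mu2 a n * l) (mv0 a n + mv1 a n * y + mv2 a n * l) ->
  y = ynum /\ l = lnum.
Proof.
move=> lty ltl s; have [] := mask_prefix lty ltl s (leqnn _).
by rewrite !modn_small.
Qed.

(** Digit [n] of the pair code is [b_n], and its top digit is [low b_n - 1]; their quotient, after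
    restoring the 1, is the odd part of [b_n]. *)
Lemma odd_collatz_digits :
  odd_collatz a n = (ynum + E * lnum) %/ M ^ n %% M
                    %/ ((ynum + E * lnum) %/ E %/ M ^ n + 1).
Proof.
have E_gt1 := box_gt1; have M_gt1 := dbase_gt1.
have lt_n : n < n + 1 by rewrite addn1.
have [lt_b _ _ _] := digits_small lt_n.
rewrite [ynum + _]addnC mulnC divnMDl ?(divn_small ynum_lt) ?addn0; last by lia.
have ltn f : (forall j, j < n + 1 -> f j < M) -> digsum M f n < M ^ n.
  by move=> ltf; apply: ltn_digsum => j ltj; apply: ltf; lia.
have Mn_gt0 : 0 < M ^ n by rewrite expn_gt0; lia.
have -> : lnum %/ M ^ n = low (b n) - 1.
  rewrite /lnum addn1 digsumS addnC mulnC divnMDl // divn_small ?addn0 //.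
  by apply: ltn => j /digits_small[].
have -> : lnum * E + ynum = (lnum * M + b n) * M ^ n + digsum M b n.
  by rewrite /ynum /box addn1 digsumS expnS; ring.
have lt_low : digsum M b n < M ^ n by apply: ltn => j /digits_small[].
rewrite divnMDl // (divn_small lt_low) addn0.
rewrite modnMDl modn_small // subnK ?low_gt0 //.
have [_ {1}->] := collatz_num_odd_collatz n odd_a.
by rewrite mulKn ?low_gt0.
Qed.

End Encoding.

(** * Isolating the solution modulo a power of 2 and reading it off *)

(** Only the solution's term survives modulo [2 ^ H]. Its binomial coefficient [d] is the same for
    all [th], so that two choices of [th] suffice to cancel it. *)
Lemma wbin_sum_mod (E q H v0 v1 v2 u0 u2 : nat) (y0 l0 : 'I_E) :
  u0 + u2 * E < 2 ^ q -> v0 + (v1 + v2) * E < 2 ^ q ->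
  submask (u0 + u2 * l0) (v0 + v1 * y0 + v2 * l0) ->
  (forall y l : 'I_E, submask (u0 + u2 * l) (v0 + v1 * y + v2 * l) ->
     y = y0 /\ l = l0) ->
  let rho := repunit (2 ^ q) H in
  exists2 d, odd d & forall th,
    wbin_sum E (v0 * rho) (v1 * rho) (v2 * rho) (u0 * rho) (u2 * rho) th
    = th ^ (y0 + E * l0) * d %[mod 2 ^ H].
Proof.
move=> ltu ltv sub0 uniq0 rho.
have ltU (l : 'I_E) : u0 + u2 * l < 2 ^ q.
  by apply: leq_ltn_trans ltu; rewrite leq_add2l leq_mul2l (ltnW (ltn_ord l)) orbT.
have ltV (y l : 'I_E) : v0 + v1 * y + v2 * l < 2 ^ q.
  apply: leq_ltn_trans ltv; rewrite -addnA leq_add2l mulnDl.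
  by rewrite leq_add // leq_mul2l (ltnW (ltn_ord _)) orbT.
exists 'C((v0 + v1 * y0 + v2 * l0) * rho, (u0 + u2 * l0) * rho).
  by apply: odd_bin_submask; apply: submask_rep.
move=> th.
have VE (y l : nat) : v0 * rho + v1 * rho * y + v2 * rho * l
    = (v0 + v1 * y + v2 * l) * rho by ring.
have UE (l : nat) : u0 * rho + u2 * rho * l = (u0 + u2 * l) * rho by ring.
rewrite /wbin_sum (bigD1 (y0, l0)) //= VE UE addnC.
set S := \sum_(_ | _) _; suff /dvdnP[k ->] : 2 ^ H %| S by rewrite modnMDl.
apply: dvdn_sum => [[y l] /= ne]; apply: dvdn_mull; rewrite VE UE.
apply: dvdn_bin_rep => // /uniq0[ey el]; by rewrite ey el eqxx in ne.
Qed.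

Lemma expn_1D_sq x y : (1 + x ^ 2) ^ y = 1 + y * x ^ 2 %[mod x ^ 4].
Proof.
elim: y => [|y IH]; first by rewrite mul0n.
rewrite expnS -modnMmr IH modnMmr.
rewrite (_ : (1 + x ^ 2) * (1 + y * x ^ 2) = y * x ^ 4 + (1 + y.+1 * x ^ 2)).
  by rewrite modnMDl.
by rewrite -[y.+1]addn1; ring.
Qed.

(** The power of [c1] inverts [d] modulo [E ^ 4], and [z < E ^ 2] keeps [1 + z * E ^ 2] below the
    modulus. *)
Lemma recover_exponent (E H z d c1 c2 : nat) : 2 ^ H = E ^ 4 -> 1 < E -> z < E ^ 2 ->
  odd d -> c1 = d %[mod E ^ 4] -> c2 = (1 + E ^ 2) ^ z * d %[mod E ^ 4] ->
  (c2 * c1 ^ (E ^ 4 - 1)) %% E ^ 4 %/ E ^ 2 = z.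
Proof.
move=> HE E_gt1 ltz odd_d c1E c2E.
have E4_gt0 : 0 < E ^ 4 by rewrite expn_gt0; case: E E_gt1 {HE ltz c1E c2E}.
have E2_gt1 : 1 < E ^ 2 by rewrite -[1]/(1 ^ 2) ltn_exp2r.
have H_gt0 : 0 < H by rewrite -(@ltn_exp2l 2) // HE -[2 ^ 0]/(1 ^ 4) ltn_exp2r.
have dE : d ^ (E ^ 4) = 1 %[mod E ^ 4].
  have co : coprime d (2 ^ H) by rewrite coprimeXr // coprimen2.
  have := Euler_exp_totient co; rewrite totient_pfactor // mul1n => ed.
  (* Euler's exponent for [2 ^ H] is [2 ^ (H - 1)], half of [E ^ 4]. *)
  have -> : d ^ (E ^ 4) = (d ^ (2 ^ H.-1)) ^ 2 by rewrite -HE -expnM -expnSr prednK.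
  by rewrite -HE -modnXm ed modnXm exp1n.
rewrite -modnMml c2E modnMml -modnMmr -modnXm c1E modnXm modnMmr.
rewrite -mulnA -expnS subn1 prednK // -modnMmr dE modnMmr muln1 expn_1D_sq.
have E4 : E ^ 4 = E ^ 2 * E ^ 2 by rewrite -expnD.
rewrite E4 modn_small; first by rewrite addnC divnMDl ?(ltnW E2_gt1) // divn_small ?addn0.
apply: (@leq_trans (z.+1 * E ^ 2)); first by rewrite mulSn ltn_add2r.
by rewrite leq_mul2r ltz orbT.
Qed.

(** * Closure properties of arithmetic terms *)

Definition representable (f : nat -> nat -> nat) : Prop :=
  exists Q : arith_term 2, forall a n, arith_eval [tuple a; n] Q = f a n.

Section Representable.
Variables f g : nat -> nat -> nat.

Lemma representable_fst : representable (fun a _ => a).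
Proof. by exists (AVar ord0). Qed.

Lemma representable_snd : representable (fun _ n => n).
Proof. by exists (AVar ord_max). Qed.

Lemma representable_const c : representable (fun _ _ => c).
Proof. by exists (AConst 2 c). Qed.

Hypotheses (rep_f : representable f) (rep_g : representable g).

Lemma representable_add : representable (fun a n => f a n + g a n).
Proof.
case: rep_f rep_g => [s sE] [t tE]; exists (AAdd s t) => a n.
by rewrite /= sE tE.
Qed.

Lemma representable_sub : representable (fun a n => f a n - g a n).
Proof.
case: rep_f rep_g => [s sE] [t tE]; exists (ASub s t) => a n.
by rewrite /= sE tE.
Qed.

Lemma representable_mul : representable (fun a n => f a n * g a n).
Proof.
case: rep_f rep_g => [s sE] [t tE]; exists (AMul s t) => a n.
by rewrite /= sE tE.
Qed.

Lemma representable_div : representable (fun a n => f a n %/ g a n).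
Proof.
case: rep_f rep_g => [s sE] [t tE]; exists (ADiv s t) => a n.
by rewrite /= sE tE.
Qed.

Lemma representable_mod : representable (fun a n => f a n %% g a n).
Proof.
case: rep_f rep_g => [s sE] [t tE]; exists (AMod s t) => a n.
by rewrite /= sE tE.
Qed.

Lemma representable_exp : representable (fun a n => f a n ^ g a n).
Proof.
case: rep_f rep_g => [s sE] [t tE]; exists (AExp s t) => a n.
by rewrite /= sE tE.
Qed.

End Representable.

Ltac represent :=
  lazymatch goal with
  | |- representable (fun a _ => a) => exact: representable_fst
  | |- representable (fun _ n => n) => exact: representable_snd
  | |- representable (fun _ _ => ?c) => exact: representable_const
  | |- representable (fun a n => @?f a n + @?g a n) =>
      apply: (@representable_add f g); represent
  | |- representable (fun a n => @?f a n - @?g a n) =>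
      apply: (@representable_sub f g); represent
  | |- representable (fun a n => @?f a n * @?g a n) =>
      apply: (@representable_mul f g); represent
  | |- representable (fun a n => @?f a n %/ @?g a n) =>
      apply: (@representable_div f g); represent
  | |- representable (fun a n => @?f a n %% @?g a n) =>
      apply: (@representable_mod f g); represent
  | |- representable (fun a n => @?f a n ^ @?g a n) =>
      apply: (@representable_exp f g); represent
  | _ => assumption
  end.

(** * Assembling the arithmetic term *)

Definition mask_size (a n : nat) : nat :=
  mu0 a n + mu2 a n * box a n + mv0 a n + (mv1 a n + mv2 a n) * box a n.
(** The number [H] of copies for which [2 ^ H = box a n ^ 4]. *)
Definition copies (a n : nat) : nat := 4 * (width a n * (n + 1)).
Definition rep_factor (a n : nat) : nat :=
  ((2 ^ mask_size a n) ^ copies a n - 1) %/ (2 ^ mask_size a n - 1).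

Lemma representable_width : representable width.
Proof. by rewrite /width; represent. Qed.

Lemma representable_dbase : representable dbase.
Proof. by have rep_w := representable_width; rewrite /dbase; represent. Qed.

Lemma representable_box : representable box.
Proof. by have rep_M := representable_dbase; rewrite /box; represent. Qed.

Lemma representable_dunit : representable dunit.
Proof.
have rep_M := representable_dbase; have rep_E := representable_box.
by rewrite /dunit; represent.
Qed.

Lemma representable_masks :
  [/\ representable mu0, representable mu2, representable mv0,
      representable mv1 & representable mv2].
Proof.
have rep_M := representable_dbase; have rep_E := representable_box.
have rep_R := representable_dunit.
by split; rewrite /mu0 /mu2 /mv0 /mv1 /mv2; represent.
Qed.

Lemma representable_copies : representable copies.
Proof. by have rep_w := representable_width; rewrite /copies; represent. Qed.

Lemma representable_rep_factor : representable rep_factor.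
Proof.
have rep_E := representable_box; have rep_H := representable_copies.
have [rep_u0 rep_u2 rep_v0 rep_v1 rep_v2] := representable_masks.
have rep_q : representable mask_size by rewrite /mask_size; represent.
by rewrite /rep_factor; represent.
Qed.

Definition weighted_sum (th : nat -> nat -> nat) (a n : nat) : nat :=
  wbin_sum (box a n) (mv0 a n * rep_factor a n) (mv1 a n * rep_factor a n)
    (mv2 a n * rep_factor a n) (mu0 a n * rep_factor a n) (mu2 a n * rep_factor a n)
    (th a n).

Lemma rep_factorE a n :
  rep_factor a n = repunit (2 ^ mask_size a n) (copies a n).
Proof.
rewrite repunitE // -[1]/(2 ^ 0) ltn_exp2l //.
rewrite /mask_size /mu2; have := box_gt1 a n; lia.
Qed.

Lemma rep_factor_gt0 a n : 0 < rep_factor a n.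
Proof.
rewrite rep_factorE; have : 0 < copies a n.
  by rewrite /copies /width !addn1 !muln_gt0.
by case: (copies a n) => // H _; rewrite repunitS.
Qed.

(** The number of summands varies with [a] and [n]; [wbin_sumE] replaces the sum by an expression of
    fixed shape. *)
Lemma representable_weighted_sum th : (forall a n, 0 < th a n) ->
  representable th -> representable (weighted_sum th).
Proof.
move=> th_gt0 rep_th; have rep_E := representable_box.
have rep_rho := representable_rep_factor.
have [rep_u0 rep_u2 rep_v0 rep_v1 rep_v2] := representable_masks.
pose base a n := wbin_base (box a n) (mv0 a n * rep_factor a n)
  (mv1 a n * rep_factor a n) (mv2 a n * rep_factor a n) (th a n).
have rep_base : representable base by rewrite /base /wbin_base; represent.
pose gf a n := wbin_gf (box a n) (mv0 a n * rep_factor a n)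
  (mv1 a n * rep_factor a n) (mv2 a n * rep_factor a n) (mu2 a n * rep_factor a n)
  (th a n).
have rep_gf : representable gf.
  by rewrite /gf /wbin_gf /geom -/base; represent.
have [Q QE] : representable (fun a n =>
    gf a n %/ base a n ^ (mu0 a n * rep_factor a n
                          + mu2 a n * rep_factor a n * (box a n - 1)) %% base a n).
  by represent.
exists Q => a n; have E_gt1 := box_gt1 a n; have M_gt1 := dbase_gt1 a n.
rewrite QE /weighted_sum wbin_sumE //.
- by rewrite muln_gt0 rep_factor_gt0 andbT /mv1 addn_gt0.
- rewrite muln_gt0 rep_factor_gt0 andbT /mv2 !muln_gt0 /=.
  by rewrite addn_gt0 (ltnW E_gt1).
by rewrite leq_mul2r /mu2 /mv2; apply/orP; right; nia.
Qed.

Theorem mainTheorem8 :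
  exists Q : arith_term 2, forall a n : nat, odd a ->
    odd_collatz a n = arith_eval [tuple a; n] Q %/ (2 ^ n.+1 * a) ^ n.
Proof.
have rep_E := representable_box; have rep_M := representable_dbase.
pose th a n := 1 + box a n ^ 2.
have rep_1 : representable (weighted_sum (fun _ _ => 1)).
  by apply: representable_weighted_sum => //; represent.
have rep_2 : representable (weighted_sum th).
  by apply: representable_weighted_sum => //; rewrite /th; represent.
pose z a n := (weighted_sum th a n * weighted_sum (fun _ _ => 1) a n ^ (box a n ^ 4 - 1))
  %% box a n ^ 4 %/ box a n ^ 2.
have rep_z : representable z by rewrite /z; represent.
(* The value is multiplied by the prescribed denominator, which is positive for odd [a], so the
   final division is exact. *)
have [Q QE] : representable (fun a n =>
    z a n %/ dbase a n ^ n %% dbase a n %/ (z a n %/ box a n %/ dbase a n ^ n + 1)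
    * (2 ^ (n + 1) * a) ^ n) by represent.
exists Q => a n odd_a; have a_gt0 := odd_gt0 odd_a.
rewrite QE -[n.+1]addn1 mulnK; last by rewrite !expn_gt0 muln_gt0 expn_gt0 a_gt0.
rewrite (odd_collatz_digits n odd_a).
suff -> : z a n = ynum a n + box a n * lnum a n by [].
have lty := ynum_lt n odd_a; have ltl := lnum_lt n odd_a.
have E_gt1 := box_gt1 a n.
(* [mask_size] bounds every mask [u] and [v], hence also serves as their number of binary digits. *)
have ltq : mask_size a n < 2 ^ mask_size a n by apply: ltn_expl.
have [||||d odd_d wE] := @wbin_sum_mod (box a n) (mask_size a n) (copies a n)
  (mv0 a n) (mv1 a n) (mv2 a n) (mu0 a n) (mu2 a n) (Ordinal lty) (Ordinal ltl).
- by apply: leq_ltn_trans ltq; rewrite /mask_size -addnA leq_addr.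
- by apply: leq_ltn_trans ltq; rewrite /mask_size -addnA leq_addl.
- exact: mask_ynum_lnum.
- move=> y l /(mask_unique odd_a (ltn_ord y) (ltn_ord l))[ey el].
  by split; apply: val_inj.
have HE : 2 ^ copies a n = box a n ^ 4 by rewrite boxE -expnM mulnC.
rewrite -rep_factorE HE /= in wE.
apply: (recover_exponent HE E_gt1 _ odd_d).
- have lt_l : lnum a n <= box a n - 1 by rewrite subn1 -ltnS prednK // ltnW.
  by rewrite -mulnn; nia.
- by rewrite /weighted_sum wE exp1n mul1n.
exact: wE.
Qed.
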